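(* Let $\mathcal{S}=\langle\mathcal{L},\vdash\rangle$ be a logic and $\alpha,\beta\in\mathcal{L}$. (1) (Quasi double negation) For every quasi-negation $\sim\!\alpha$ of $\alpha$, $\alpha$ is a quasi-negation of $\sim\!\alpha$; i.e. $\alpha\in QN(\sim\!\alpha)$. (2) (Quasi contraposition) $\alpha\in QN(\beta)$ if and only if $\beta\in QN(\alpha)$. (3) If $\langle\mathcal{L},\vdash\rangle$ is Tarskian and $\{\alpha\}\vdash\beta$, then any quasi-negation of $\beta$ is a quasi-negation of $\alpha$; i.e. $QN(\beta)\subseteq QN(\alpha)$.
   Context: A logic is a pair $\langle\mathcal{L},\vdash\rangle$ where $\mathcal{L}$ is a set (of formulas) and $\vdash\,\subseteq\mathcal{P}(\mathcal{L})\times\mathcal{L}$ is a relation (not assumed to be Tarskian here unless stated). For $\Gamma\subseteq\mathcal{L}$, $C_\vdash(\Gamma)=\{\gamma\in\mathcal{L}\mid\Gamma\vdash\gamma\}$. The logic is Tarskian if it satisfies: reflexivity ($\alpha\in\Gamma$ implies $\Gamma\vdash\alpha$), monotonicity ($\Gamma\vdash\alpha$ and $\Gamma\subseteq\Sigma$ imply $\Sigma\vdash\alpha$), and transitivity (if $\Gamma\vdash\beta$ for all $\beta\in\Delta$ and $\Delta\vdash\gamma$, then $\Gamma\vdash\gamma$). For $\alpha\in\mathcal{L}$, a quasi-negation of $\alpha$ is any $\beta\in\mathcal{L}$ such that $C_\vdash(\{\alpha,\beta\})=\mathcal{L}$. A quasi-negation of $\alpha$ (which need not exist or be unique) is denoted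 $\sim\!\alpha$, and $QN(\alpha)$ denotes the set of all quasi-negations of $\alpha$. *)

(* Defs.v *)
From mathcomp Require Import all_boot.
From mathcomp Require Import classical_sets.

Set Implicit Arguments.
Unset Strict Implicit.
Unset Printing Implicit Defensive.

Local Open Scope classical_set_scope.

(* No condition at all is imposed on the consequence relation. *)
Record logic := Logic {
  formula : Type;
  entails : set formula -> formula -> Prop
}.

Definition consequences (S : logic) (Gamma : set (formula S)) :
  set (formula S) := [set gamma | entails Gamma gamma].

Record tarskian (S : logic) : Prop := Tarskian {
  tarskian_refl : forall (Gamma : set (formula S)) (alpha : formula S),
    Gamma alpha -> entails Gamma alpha;
  tarskian_mono : forall (Gamma Sigma : set (formula S)) (alpha : formula S),
    entails Gamma alpha -> Gamma `<=` Sigma -> entails Sigma alpha;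
  tarskian_trans : forall (Gamma Delta : set (formula S)) (gamma : formula S),
    (forall beta, Delta beta -> entails Gamma beta) ->
    entails Delta gamma -> entails Gamma gamma
}.

(* Read: beta is a quasi-negation of alpha. *)
Definition quasi_negation (S : logic) (alpha beta : formula S) : Prop :=
  consequences [set alpha; beta] = setT.

Definition QN (S : logic) (alpha : formula S) : set (formula S) :=
  [set beta | quasi_negation alpha beta].

(* Main.v *)
Require Import Defs.
From mathcomp Require Import all_boot.
From mathcomp Require Import classical_sets.
Local Open Scope classical_set_scope.

(** The pair {alpha, beta} is unordered, so quasi-negation is a symmetric relation over any
    consequence relation; this gives (1) and (2). For (3), {alpha, gamma} derives both members of
    the explosive pair {beta, gamma}, hence explodes too ([QN_antitone]). *)

Lemma quasi_negation_sym (S : logic) (alpha beta : formula S) :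
  quasi_negation alpha beta -> quasi_negation beta alpha.
Proof. by rewrite /quasi_negation setUC. Qed.

Lemma QN_antitone (S : logic) (alpha beta : formula S) :
  tarskian S -> entails [set alpha] beta -> QN beta `<=` QN alpha.
Proof.
move=> tS alpha_beta gamma beta_gamma.
apply/seteqP; split=> // delta _.
have beta_gamma_delta : entails [set beta; gamma] delta.
  by have /seteqP[_ /(_ delta I)] := beta_gamma.
(* Cut through [[set beta; gamma]]: from [[set alpha; gamma]], [beta] follows by weakening
   [alpha_beta], and [gamma] is itself a premise. *)
apply: (tarskian_trans tS) beta_gamma_delta => _ [->|->].
- by apply: (tarskian_mono tS) alpha_beta _; left.
- by apply: (tarskian_refl tS); right.
Qed.

Theorem theorem2p17 (S : logic) (alpha beta : formula S) :
  (forall nalpha : formula S, QN alpha nalpha -> QN nalpha alpha) /\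
  (QN beta alpha <-> QN alpha beta) /\
  (tarskian S -> entails [set alpha] beta -> QN beta `<=` QN alpha).
Proof.
split; first by move=> nalpha; exact: quasi_negation_sym.
split; first by split; exact: quasi_negation_sym.
exact: QN_antitone.
Qed.
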